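(* Consider the production-destruction system $\frac{dc_i}{dt}=\sum_{j=1}^M p_{ij}(c)-\sum_{j=1}^M d_{ij}(c)$, $i=1,\dots,M$, with $p_{ij}(c)=d_{ji}(c)\ge 0$, and the modified Patankar multistep scheme $$c_i^{n+1}=\frac14 c_i^{n-2}+\frac34 c_i^n+\frac32\Delta t\left(\sum_{j=1}^M p_{ij}(c^n)\frac{c_j^{n+1}}{\sigma_j}-\sum_{j=1}^M d_{ij}(c^n)\frac{c_i^{n+1}}{\sigma_i}\right),\qquad i=1,\dots,M.$$ This scheme is second-order accurate with $$\sigma_i=(c_i^n)^s(c_i^{n-1})^r(c_i^{n-2})^{1-r-s}\qquad\text{and}\qquad r+2s-3=0.$$ Moreover, it is conservative in the sense that $$\sum_{i=1}^M c_i^{n-2}=\sum_{i=1}^M c_i^{n-1}=\sum_{i=1}^M c_i^{n}=\sum_{i=1}^M c_i^{n+1},$$ and it is unconditionally positivity-preserving (that is, with no restriction on the time step $\Delta t>0$): if $c_i^n\ge 0$ for $i=1,2,\dots,M$, then $c_i^{n+1}\ge 0$ for $i=1,2,\dots,M$.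
   Context: Here $c=(c_1,\dots,c_M)^T$ is the vector of concentrations of the $M$ components, $c_i^m$ denotes the numerical approximation of $c_i(t^m)$ at time level $m$ on a uniform time grid with step $\Delta t$, and $c^m=(c_1^m,\dots,c_M^m)^T$. The function $p_{ij}$ is the production rate (transformation of component $j$ into component $i$) and $d_{ij}$ the destruction rate (transformation of component $i$ into component $j$). The parameters $s,r$ are real numbers. Second-order accuracy is meant in the usual sense that the local truncation error of the scheme is $O(\Delta t^3)$.
   Formalization: Conservation assumes that the three starting values have equal total mass; positivity assumes that all known levels n-2, n-1, n are nonnegative; second-order accuracy is for strictly positive, three times continuously differentiable solutions and continuous production rates. *)

(* Defs.v *)
From HB Require Import structures.
From mathcomp Require Import all_boot all_order all_algebra.
From mathcomp Require Import all_classical all_reals all_analysis.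

Set Implicit Arguments.
Unset Strict Implicit.
Unset Printing Implicit Defensive.

Import Order.TTheory GRing.Theory Num.Theory.
Import numFieldNormedType.Exports.

Local Open Scope classical_set_scope.
Local Open Scope ring_scope.

Section ModifiedPatankarMultistep.
Variables (R : realType) (M : nat).

Implicit Types (p d : 'I_M -> 'I_M -> 'rV[R]_M -> R) (s r dt : R).
Implicit Types (u v w z : 'rV[R]_M) (c : R -> 'rV[R]_M).

Definition nonneg_state u : Prop := forall i, 0 <= u 0 i.

Definition pos_state u : Prop := forall i, 0 < u 0 i.

Definition mass u : R := \sum_(i < M) u 0 i.

Definition pds_rhs p d u (i : 'I_M) : R :=
  \sum_(j < M) p i j u - \sum_(j < M) d i j u.

(* In the definitions below u, v, w, z stand for the values at the time levels
   n-2, n-1, n, n+1.  The exponents are real, hence powR: 0 `^ x is 0 for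
   x != 0 and 1 for x = 0.  With x / 0 = 0, the terms of the scheme weighted by
   a vanishing sigma_i drop out. *)
Definition sigma s r u v w (i : 'I_M) : R :=
  (w 0 i `^ s) * (v 0 i `^ r) * (u 0 i `^ (1 - r - s)).

Definition mp_rhs p d s r dt u v w z (i : 'I_M) : R :=
  1 / 4 * u 0 i + 3 / 4 * w 0 i
  + 3 / 2 * dt * (\sum_(j < M) p i j w * (z 0 j / sigma s r u v w j)
                  - \sum_(j < M) d i j w * (z 0 i / sigma s r u v w i)).

(* The scheme is implicit: z occurs on both sides. *)
Definition mp_step p d s r dt u v w z : Prop :=
  forall i, z 0 i = mp_rhs p d s r dt u v w z i.

Definition C3_on (a b : R) (f : R -> R) : Prop :=
  (forall k t, (k < 3)%N -> a < t < b -> derivable (derive1n k f) t 1) /\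
  (forall t, a < t < b -> {for t, continuous (derive1n 3 f)}).

Definition smooth_pos_solution p d (a b : R) c : Prop :=
  [/\ forall i, C3_on a b (fun t => c t 0 i),
      forall t, a < t < b -> pos_state (c t) &
      forall i t, a < t < b -> is_derive t 1 (fun x => c x 0 i)
                                 (pds_rhs p d (c t) i)].

(* Defect left when the exact solution is inserted at all four time levels. *)
Definition residual p d s r c (t dt : R) (i : 'I_M) : R :=
  c (t + dt) 0 i -
  mp_rhs p d s r dt (c (t - 2 * dt)) (c (t - dt)) (c t) (c (t + dt)) i.

(* The local truncation error is O(dt^3), uniformly over the time levels
   t = t^n whose stencil lies in a compact interval [t0, T] of existence.
   Both usual forms of this error are bounded: the residual, and the error of
   one step started from exact data. *)
Definition second_order_accurate p d s r : Prop :=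
  forall (a b : R) c, smooth_pos_solution p d a b c ->
  forall t0 T : R, a < t0 -> T < b ->
  exists K : R, \forall dt \near 0^'+,
    forall t, t0 <= t - 2 * dt -> t + dt <= T -> forall i,
      `|residual p d s r c t dt i| <= K * dt ^+ 3 /\
      (forall z, mp_step p d s r dt (c (t - 2 * dt)) (c (t - dt)) (c t) z ->
        `|z 0 i - c (t + dt) 0 i| <= K * dt ^+ 3).

(* The run C 0, ..., C N stops at level N; its first three levels are the
   starting values of the multistep scheme. *)
Definition mp_run p d s r dt (N : nat) (C : nat -> 'rV[R]_M) : Prop :=
  forall n, (n.+2 < N)%N ->
    mp_step p d s r dt (C n) (C n.+1) (C n.+2) (C n.+3).

(* Equality of the masses of the starting values is not produced by the scheme
   and has to be supplied. *)
Definition conservative p d s r : Prop :=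
  forall dt (N : nat) (C : nat -> 'rV[R]_M), 0 < dt ->
  mp_run p d s r dt N C ->
  mass (C 0%N) = mass (C 1%N) -> mass (C 1%N) = mass (C 2%N) ->
  forall n, (n.+2 < N)%N ->
    [/\ mass (C n) = mass (C n.+1),
        mass (C n.+1) = mass (C n.+2) &
        mass (C n.+2) = mass (C n.+3)].

Definition positivity_preserving p d s r : Prop :=
  forall dt u v w z, 0 < dt -> mp_step p d s r dt u v w z ->
  nonneg_state u -> nonneg_state v -> nonneg_state w -> nonneg_state z.

End ModifiedPatankarMultistep.

(* Main.v *)
Require Import Defs.
From HB Require Import structures.
From mathcomp Require Import all_boot all_order all_algebra.
From mathcomp Require Import all_classical all_reals all_analysis.
From mathcomp Require Import ring lra.
Import Order.TTheory GRing.Theory Num.Theory.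
Import numFieldNormedType.Exports.
Local Open Scope classical_set_scope.
Local Open Scope ring_scope.

(** The right-hand side of the scheme moves mass along exchange terms: what
    component i receives from j is exactly what j loses to i.  What one
    implicit step does follows from this antisymmetry and from p_ij >= 0.

    Summed over i, the exchange terms cancel ([exchange_sum0]), so the mass of
    the new level is 1/4 of that of level n-2 plus 3/4 of that of level n
    ([mp_step_mass]); equal masses propagate by induction.

    Tested against the signs of the unknown, the exchange terms sum to at most
    0, since the sign pattern is optimal for the losses and possibly not for
    the gains.  Hence the implicit operator has an inverse of l1 norm at most
    1, whatever dt is ([patankar_l1_stable]).  Positivity is a corollary: for
    a nonnegative explicit part, the l1 norm of the new level is at most the
    sum of the explicit part, which is the mass of the new level, and an l1
    norm bounded by the sum of the entries leaves no room for a negative entry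
    ([mp_step_ge0]).  The same stability, applied to the difference between
    the new level and the exact solution, bounds the one-step error by the
    residual ([mp_step_error_le]), so that only the residual has to be
    expanded.

    For the residual, with f = c_i, the combination
    f(t + dt) - f(t - 2 dt) / 4 - 3 f(t) / 4 - 3/2 dt f'(t) has no terms of order 0, 1 and 2 in dt, so
    it is O(dt^3) ([multistep_defect_le]).  The Patankar weights contribute
    terms +- 3/2 dt p (c_j(t + dt) / sigma_j - 1), where p is a production
    rate at c(t), so sigma_j has to agree with c_j(t + dt) up to O(dt^2).  In
    logarithms the geometric mean sigma_j is an affine combination, with
    weights s, r and 1 - r - s, of the values of ln c_j at t, t - dt and
    t - 2 dt.  It gives the value at t + dt of affine functions if and only if
    - r - 2 (1 - r - s) = 1, which is r + 2 s = 3; the error is then second order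
    ([extrapolation_le], [weights_consistent]).  All constants are uniform in
    t because c and its derivatives, 1 / c_j and p_ij(c) are continuous on the
    compact interval [t0, T]. *)

(** * Exchange terms and l1 stability *)

Lemma exchange_sum0 {R : pzRingType} {M : nat} (P : 'I_M -> 'I_M -> R)
    (y : 'I_M -> R) :
  \sum_i (\sum_j P i j * y j - \sum_j P j i * y i) = 0.
Proof. by rewrite sumrB [X in _ - X]exchange_big /= subrr. Qed.

(** Multiply by the sign of e i and sum.  After exchanging indices the
    contribution of the pair (i, j) is P i j (sg (e i) e j - |e j|) / wt j,
    which is never positive.  Weights may vanish: with the convention
    x / 0 = 0 the corresponding terms are 0. *)
Lemma patankar_l1_stable {R : realFieldType} {M : nat} {P : 'I_M -> 'I_M -> R}
    {wt e g : 'I_M -> R} {D : R} :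
  0 <= D -> (forall i j, 0 <= P i j) -> (forall i, 0 <= wt i) ->
  (forall i, e i = g i + D * (\sum_j P i j * (e j / wt j)
                              - \sum_j P j i * (e i / wt i))) ->
  \sum_i `|e i| <= \sum_i `|g i|.
Proof.
move=> D0 P0 wt0 eE.
pose f i j := P i j * (Num.sg (e i) * (e j / wt j) - `|e j| / wt j).
have sumE : \sum_i `|e i| = \sum_i Num.sg (e i) * g i
    + D * \sum_i \sum_j f i j.
  have -> : \sum_i \sum_j f i j = \sum_i Num.sg (e i) *
      (\sum_j P i j * (e j / wt j) - \sum_j P j i * (e i / wt i)).
    under [RHS]eq_bigr do rewrite mulrBr !mulr_sumr.
    rewrite sumrB [X in _ - X]exchange_big /= -sumrB.
    apply: eq_bigr => i _; rewrite -sumrB; apply: eq_bigr => j _.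
    by rewrite /f [`|e j|]normrEsg; ring.
  rewrite mulr_sumr -big_split /=; apply: eq_bigr => i _.
  by rewrite normrEsg {2}(eE i); ring.
rewrite sumE -[leRHS]addr0 lerD //.
  apply: ler_sum => i _; apply: le_trans (ler_norm _) _.
  by rewrite normrM normr_sg ler_piMl// lern1 leq_b1.
apply: mulr_ge0_le0 => //; apply: sumr_le0 => i _; apply: sumr_le0 => j _.
apply: mulr_ge0_le0 => //; rewrite subr_le0 mulrA ler_wpM2r ?invr_ge0//.
apply: le_trans (ler_norm _) _.
by rewrite normrM normr_sg ler_piMl// lern1 leq_b1.
Qed.

(** * Uniform bounds and Taylor remainders on a segment *)

(** The index i makes one constant serve all components, or all pairs of
    components, of the system. *)
Lemma bounded_on_segment {R : realType} {I : finType} {f : I -> R -> R}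
    {a b t0 T : R} :
  a < t0 -> T < b ->
  (forall i t, a < t < b -> {for t, continuous (f i)}) ->
  exists2 B : R, 0 <= B &
    forall i t, t0 <= t -> t <= T -> `|f i t| <= B.
Proof.
move=> at0 Tb fc; have [t0T|Tt0] := leP t0 T; last first.
  exists 0 => [|i t t0t tT]; first exact: lexx.
  by move: (lt_le_trans Tt0 (le_trans t0t tT)); rewrite ltxx.
have bd i : exists B, forall t, t0 <= t -> t <= T -> `|f i t| <= B.
  have : {within `[t0, T], continuous (fun t => `|f i t|)}.
    apply: continuous_in_subspaceT => t; rewrite inE /= in_itv /= => /andP[? ?].
    apply: continuous_comp; last exact: norm_continuous.
    by apply: fc; apply/andP; split; lra.
  move=> /(EVT_max t0T)[x _ xmax]; exists `|f i x| => t t0t tT.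
  by apply: xmax; rewrite in_itv /= t0t tT.
have [B fB] := choice bd.
exists (\sum_i `|B i|); first exact: sumr_ge0.
move=> i t t0t tT; apply: le_trans (fB i t t0t tT) _.
by rewrite (bigD1 i) //= (le_trans (ler_norm _)) ?lerDl ?sumr_ge0.
Qed.

Lemma is_derive_continuous {R : realType} {f : R -> R} {t l : R} :
  is_derive t 1 f l -> {for t, continuous f}.
Proof.
move=> df; apply: differentiable_continuous; apply/derivable1_diffP.
exact: ex_derive.
Qed.

(** Induction on n: the remainder of order n.+1, as a function of y, vanishes
    at x and its derivative is the remainder of order n of the derivative, so
    the mean value theorem gains one factor |y - x|.  The derivatives are
    given as a sequence F, so that closed formulas valid on the segment only,
    as for the logarithm below, can be used. *)
Lemma taylor_remainder_le {R : realType} {t0 T B : R} {n : nat}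
    {F : nat -> R -> R} :
  (forall k t, (k < n)%N -> t0 <= t -> t <= T ->
     is_derive t 1 (F k) (F k.+1 t)) ->
  (forall t, t0 <= t -> t <= T -> `|F n t| <= B) ->
  forall x y, t0 <= x -> x <= T -> t0 <= y -> y <= T ->
  `|F 0%N y - \sum_(k < n) F k x / k`!%:R * (y - x) ^+ k|
    <= B * `|y - x| ^+ n.
Proof.
elim: n F => [|n IH] F dF Fb x y t0x xT t0y yT.
  by rewrite big_ord0 subr0 expr0 mulr1; exact: Fb.
pose G z := F 0%N z - \sum_(k < n.+1) F k x / k`!%:R * (z - x) ^+ k.
pose G' z := F 1%N z - \sum_(k < n) F k.+1 x / k`!%:R * (z - x) ^+ k.
have dG z : t0 <= z -> z <= T -> is_derive z 1 G (G' z).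
  move=> t0z zT.
  have d0 := dF 0%N z isT t0z zT.
  (* The term k = 0 has derivative 0; the others shift down by one index. *)
  have ds (k : 'I_n.+1) : is_derive z 1
      (fun u => F k x / k`!%:R * (u - x) ^+ k)
      (F k x / k`!%:R * (k%:R * (z - x) ^+ k.-1)).
    have db : is_derive z 1 (fun u : R => u - x) 1.
      by rewrite -[X in is_derive _ _ _ X]subr0; exact: is_deriveB.
    have := is_deriveZ (F k x / k`!%:R) (is_deriveX k db).
    rewrite (_ : _ \*: _ = fun u => F k x / k`!%:R * (u - x) ^+ k).
      by rewrite /GRing.scale /= mulr1.
    by apply/funext => u; rewrite !fctE.
  have := is_deriveB d0 (is_derive_sum ds).
  rewrite (_ : F 0%N - _ = G); last first.
    by apply/funext => u; rewrite /G fct_sumE.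
  move=> dGz; apply: is_derive_eq dGz _.
  rewrite big_ord_recl /= mul0r mulr0 add0r; congr (_ - _).
  apply: eq_bigr => k _; rewrite /bump /= add1n factS natrM.
  have k0 : k.+1%:R != 0 :> R by rewrite pnatr_eq0.
  have kf : k`!%:R != 0 :> R by rewrite pnatr_eq0 -lt0n fact_gt0.
  by field; apply/andP.
have G'b z : t0 <= z -> z <= T -> `|G' z| <= B * `|z - x| ^+ n.
  by move=> ? ?; apply: (IH (fun k => F k.+1)) => // k t kn; exact: dF.
have Gx : G x = 0.
  rewrite /G big_ord_recl /= subrr expr0 mulr1 divr1.
  rewrite big1 ?addr0 ?subrr// => i _.
  by rewrite expr0n mulr0.
have B0 : 0 <= B by apply: le_trans (Fb x t0x xT); exact: normr_ge0.
have mvt u v : t0 <= u -> u <= v -> v <= T ->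
    exists2 w, u <= w <= v & G v - G u = G' w * (v - u).
  move=> t0u uv vT.
  have [z||w] := @MVT_segment R G G' u v uv.
  - by rewrite in_itv /= => /andP[uz zv]; apply: dG; lra.
  - apply: continuous_in_subspaceT => z.
    rewrite inE /= in_itv /= => /andP[uz zv].
    by apply: is_derive_continuous (dG z _ _); lra.
  by rewrite in_itv /=; exists w.
suff [w [t0w wT wx ->]] : exists w, [/\ t0 <= w, w <= T,
    `|w - x| <= `|y - x| & `|G y| = `|G' w| * `|y - x|].
  rewrite exprSr mulrA ler_wpM2r//; apply: le_trans (G'b w t0w wT) _.
  by rewrite ler_wpM2l// lerXn2r ?nnegrE.
have [xy|yx] := leP x y.
  have [w /andP[xw wy] GE] := mvt x y t0x xy yT.
  exists w; split; [lra|lra| |by rewrite -normrM -GE Gx subr0].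
  by rewrite !ger0_norm; lra.
have [w /andP[yw wx] GE] := mvt y x t0y (ltW yx) xT.
exists w; split; [lra|lra|by rewrite !ler0_norm; lra|].
by rewrite (distrC y) -normrM -GE Gx sub0r normrN.
Qed.

Lemma norm_expR_sub1 {R : realType} (x : R) :
  `|expR x - 1| <= `|x| * expR `|x|.
Proof.
have ge1x := expR_ge1Dx x; have [x0|x0] := leP 0 x.
  rewrite (ger0_norm x0) ger0_norm; last lra.
  have := expR_ge1Dx (- x); rewrite expRN => h.
  have : expR x * (1 - x) <= expR x * (expR x)^-1.
    by rewrite ler_wpM2l ?expR_ge0.
  rewrite mulfV ?gt_eqF ?expR_gt0//; lra.
have : expR x <= 1 by rewrite expR_le1 ltW.
rewrite (ltr0_norm x0) => xle; rewrite ler0_norm; last lra.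
have := expR_ge1Dx (-x); nra.
Qed.

(** * Consistency of the scheme *)

(** The weights s, r, 1 - r - s sum to 1 and, because r + 2 s = 3, reproduce
    the slope of F at t; what remains are the three first-order Taylor
    remainders at distances h, h and 2 h. *)
Lemma extrapolation_le {R : realType} {t0 T B s r : R} {F : nat -> R -> R} :
  r + 2 * s - 3 = 0 ->
  (forall k t, (k < 2)%N -> t0 <= t -> t <= T ->
     is_derive t 1 (F k) (F k.+1 t)) ->
  (forall t, t0 <= t -> t <= T -> `|F 2 t| <= B) ->
  forall h t, 0 < h -> t0 <= t - 2 * h -> t + h <= T ->
  `|F 0%N (t + h) - (s * F 0%N t + r * F 0%N (t - h)
                      + (1 - r - s) * F 0%N (t - 2 * h))|
    <= B * (1 + `|r| + 4 * `|1 - r - s|) * h ^+ 2.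
Proof.
move=> rs dF Fb h t h0 t0t tT.
have rem y : t0 <= y -> y <= T ->
    `|F 0%N y - (F 0%N t + F 1%N t * (y - t))| <= B * (y - t) ^+ 2.
  move=> t0y yT; have [t0t' tT'] : t0 <= t /\ t <= T by split; lra.
  have := taylor_remainder_le dF Fb _ _ t0t' tT' t0y yT.
  rewrite !big_ord_recr big_ord0 /= real_normK ?num_real//; apply: le_trans.
  by rewrite add0r !divr1 expr0 expr1 mulr1.
have := rem (t + h); have := rem (t - h); have := rem (t - 2 * h).
set e3 := F 0%N (t - 2 * h) - _; set e2 := F 0%N (t - h) - _.
set e1 := F 0%N (t + h) - _ => b3 b2 b1.
rewrite (_ : F 0%N (t + h) - _ = e1 - r * e2 - (1 - r - s) * e3); last first.
  by rewrite /e1 /e2 /e3 (_ : r = 3 - 2 * s); [ring|lra].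
have {}b1 : `|e1| <= B * h ^+ 2 by apply: le_trans (b1 _ _) _; lra.
have {}b2 : `|e2| <= B * h ^+ 2 by apply: le_trans (b2 _ _) _; lra.
have {}b3 : `|e3| <= 4 * (B * h ^+ 2) by apply: le_trans (b3 _ _) _; lra.
apply: le_trans (ler_normB _ _) _; rewrite normrM.
apply: le_trans (lerD (ler_normB _ _) (lexx _)) _; rewrite normrM.
have := ler_wpM2l (normr_ge0 r) b2.
have := ler_wpM2l (normr_ge0 (1 - r - s)) b3.
lra.
Qed.

(** The coefficients 1/4, 3/4, 3/2 annihilate the Taylor polynomial of degree 2
    at t, leaving the remainders at distances h and 2 h, which
    give the constant 1 + 8 / 4 = 3. *)
Lemma multistep_defect_le {R : realType} {t0 T B : R} {F : nat -> R -> R} :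
  (forall k t, (k < 3)%N -> t0 <= t -> t <= T ->
     is_derive t 1 (F k) (F k.+1 t)) ->
  (forall t, t0 <= t -> t <= T -> `|F 3 t| <= B) ->
  forall h t, 0 < h -> t0 <= t - 2 * h -> t + h <= T ->
  `|F 0%N (t + h) - 1 / 4 * F 0%N (t - 2 * h) - 3 / 4 * F 0%N t
    - 3 / 2 * h * F 1%N t| <= 3 * B * h ^+ 3.
Proof.
move=> dF Fb h t h0 t0t tT.
have rem y : t0 <= y -> y <= T ->
    `|F 0%N y - (F 0%N t + F 1%N t * (y - t) + F 2 t / 2 * (y - t) ^+ 2)|
      <= B * `|y - t| ^+ 3.
  move=> t0y yT; have [t0t' tT'] : t0 <= t /\ t <= T by split; lra.
  have := taylor_remainder_le dF Fb _ _ t0t' tT' t0y yT.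
  rewrite !big_ord_recr big_ord0 /=; apply: le_trans.
  by rewrite add0r !divr1 expr0 expr1 mulr1.
have := rem (t + h); have := rem (t - 2 * h).
set e2 := F 0%N (t - 2 * h) - _.
set e1 := F 0%N (t + h) - _ => b2 b1.
rewrite (_ : _ - _ = e1 - 1 / 4 * e2); last by rewrite /e1 /e2; field.
have {}b1 : `|e1| <= B * h ^+ 3.
  apply: le_trans (b1 _ _) _; try lra.
  by rewrite addrAC subrr add0r gtr0_norm.
have {}b2 : `|e2| <= 8 * (B * h ^+ 3).
  apply: le_trans (b2 _ _) _; try lra.
  by rewrite addrAC subrr add0r normrN gtr0_norm; lra.
apply: le_trans (ler_normB _ _) _; rewrite normrM.
by rewrite (ger0_norm (_ : 0 <= 1 / 4)); lra.
Qed.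

Lemma sigma_expR {R : realType} {M : nat} (s r : R) (u v w : 'rV[R]_M) i :
  pos_state u -> pos_state v -> pos_state w ->
  sigma s r u v w i =
    expR (s * ln (w 0 i) + r * ln (v 0 i) + (1 - r - s) * ln (u 0 i)).
Proof.
move=> u0 v0 w0; rewrite /sigma /powR !gt_eqF ?u0 ?v0 ?w0//.
by rewrite !expRD.
Qed.

Lemma C3_is_derive {R : realType} {a b : R} {f : R -> R} {k t} :
  C3_on a b f -> (k < 3)%N -> a < t < b ->
  is_derive t 1 (derive1n k f) (derive1n k.+1 f t).
Proof.
move=> [df _] k3 tab; rewrite derive1nS derive1E; apply: derivableP.
exact: df.
Qed.

Lemma C3_continuous {R : realType} {a b : R} {f : R -> R} {k t} :
  C3_on a b f -> (k <= 3)%N -> a < t < b -> {for t, continuous (derive1n k f)}.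
Proof.
rewrite leq_eqVlt => fC /predU1P[->|k3] tab; first by case: fC => _; apply.
exact: is_derive_continuous (C3_is_derive fC k3 tab).
Qed.

(** Closed forms of ln f and of its first two derivatives, as a sequence of the
    shape that Taylor's formula above expects; the last branch serves k = 2. *)
Definition ln_derivs {R : realType} (f : R -> R) (k : nat) (t : R) : R :=
  match k with
  | 0 => ln (f t)
  | 1 => derive1n 1 f t / f t
  | _ => derive1n 2 f t / f t - (derive1n 1 f t / f t) ^+ 2
  end.

Lemma ln_derivsP {R : realType} {a b : R} {f : R -> R} {k t} :
  C3_on a b f -> (forall x, a < x < b -> 0 < f x) -> (k < 2)%N -> a < t < b ->
  is_derive t 1 (ln_derivs f k) (ln_derivs f k.+1 t).
Proof.
move=> fC f0 k2 tab; have ft0 := f0 t tab.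
have d0 := C3_is_derive fC (isT : (0 < 3)%N) tab.
have d1 := C3_is_derive fC (isT : (1 < 3)%N) tab.
case: k k2 => [|[|//]] _.
  apply: is_derive_eq (is_derive1_comp (is_derive1_ln ft0) d0) _.
  by rewrite mulrC.
have ftn : f t != 0 by rewrite gt_eqF.
apply: is_derive_eq (is_deriveM d1 (is_deriveV ftn d0)) _.
by rewrite /GRing.scale /=; field.
Qed.

Lemma ln_derivs_continuous {R : realType} {a b : R} {f : R -> R} {t} :
  C3_on a b f -> (forall x, a < x < b -> 0 < f x) -> a < t < b ->
  {for t, continuous (ln_derivs f 2)}.
Proof.
move=> fC f0 tab; have ftn : f t != 0 by rewrite gt_eqF ?f0.
have [c0 c1 c2] := And3 (C3_continuous fC (isT : (0 <= 3)%N) tab)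
  (C3_continuous fC (isT : (1 <= 3)%N) tab)
  (C3_continuous fC (isT : (2 <= 3)%N) tab).
have cV : {for t, continuous (fun x => (f x)^-1)} by exact: cvgV.
have cQ : {for t, continuous (fun x => derive1n 1 f x / f x)} by exact: cvgM.
apply: cvgB; first exact: cvgM.
exact: cvgM.
Qed.

(** c(t + dt) / sigma is the exponential of the extrapolation error of ln c.
    The stencil lies in [t0, T], so dt <= T - t0; this keeps the exponential
    factor of [norm_expR_sub1] bounded without any smallness of dt. *)
Lemma weights_consistent {R : realType} {M : nat} {s r a b t0 T : R}
    {c : R -> 'rV[R]_M} :
  r + 2 * s - 3 = 0 ->
  (forall i, C3_on a b (fun t => c t 0 i)) ->
  (forall t, a < t < b -> pos_state (c t)) ->
  a < t0 -> T < b ->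
  exists2 Q : R, 0 <= Q & forall dt t i, 0 < dt -> t0 <= t - 2 * dt ->
    t + dt <= T ->
    `|c (t + dt) 0 i / sigma s r (c (t - 2 * dt)) (c (t - dt)) (c t) i - 1|
      <= Q * dt ^+ 2.
Proof.
move=> rs cC c0 at0 Tb.
have [B B0 Bb] := bounded_on_segment at0 Tb (fun i t =>
  ln_derivs_continuous (t := t) (cC i) (fun x xab => c0 x xab i)).
pose C := B * (1 + `|r| + 4 * `|1 - r - s|).
have C_ge0 : 0 <= C by rewrite mulr_ge0// !addr_ge0// mulr_ge0.
exists (C * expR (C * (T - t0) ^+ 2)); first by rewrite mulr_ge0 ?expR_ge0.
move=> dt t i dt0 t0t tT.
have pos x : t0 <= x -> x <= T -> pos_state (c x).
  by move=> ? ?; apply: c0; apply/andP; split; lra.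
rewrite sigma_expR; [|by apply: pos; lra..].
rewrite -[X in X / _]lnK ?posrE; last by apply: pos; lra.
rewrite -expRN -expRD.
set E := (X in expR X); have Eb : `|E| <= C * dt ^+ 2.
  apply: (@extrapolation_le R t0 T B s r
    (ln_derivs (fun t => c t 0 i))) => // [k x k2 t0x xT|x t0x xT].
    apply: (ln_derivsP (cC i) (fun x xab => c0 x xab i)) => //.
    by apply/andP; split; lra.
  exact: Bb.
apply: le_trans (norm_expR_sub1 _) _.
rewrite mulrAC ler_pM// ?expR_ge0// ler_expR (le_trans Eb)// ler_wpM2l//.
by rewrite lerXn2r ?nnegrE; lra.
Qed.

(** Continuity of q relative to the positive states suffices, as the solution
    stays positive on a neighbourhood of t. *)
Lemma continuous_along_solution {R : realType} {M : nat}
    {q : 'rV[R]_M -> R} {c : R -> 'rV[R]_M} {a b : R} :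
  {within [set u | pos_state u], continuous q} ->
  (forall i, C3_on a b (fun t => c t 0 i)) ->
  (forall t, a < t < b -> pos_state (c t)) ->
  forall t, a < t < b -> {for t, continuous (fun x => q (c x))}.
Proof.
move=> /subspace_continuousP qc cC c0 t tab.
have c_cont : {for t, continuous c}.
  apply: differentiable_continuous; apply/derivable1_diffP/derivable_mxP => i j.
  by rewrite ord1; case: (cC j) => df _; exact: (df 0%N).
apply: (cvg_comp _ _ _ (qc (c t) (c0 t tab))).
move=> A cA.
have cA' : \forall x \near t, pos_state (c x) -> A (c x) := c_cont _ cA.
have tn : \forall x \near t, a < x < b.
  have /near_in_itvoo : t \in `]a, b[ by rewrite in_itv.
  by apply: filterS => x; rewrite in_itv.
by apply: filterS2 tn cA' => x xab; apply; exact: c0.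
Qed.

(** The exchange terms with quotients c_j(t + dt) / sigma_j replaced by 1 are
    exactly c_i'(t), by the differential equation.  This splits the residual
    into the defect of the linear multistep formula and dt times an error of
    the quotients. *)
Lemma residual_le {R : realType} {M : nat}
    {p d : 'I_M -> 'I_M -> 'rV[R]_M -> R} {s r a b t0 T : R}
    {c : R -> 'rV[R]_M} :
  (forall i j u, p i j u = d j i u) ->
  (forall i j, {within [set u | pos_state u], continuous (p i j)}) ->
  r + 2 * s - 3 = 0 -> smooth_pos_solution p d a b c -> a < t0 -> T < b ->
  exists2 K : R, 0 <= K & forall dt t i, 0 < dt -> t0 <= t - 2 * dt ->
    t + dt <= T -> `|residual p d s r c t dt i| <= K * dt ^+ 3.
Proof.
move=> pdE pc rs [cC c0 cS] at0 Tb.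
have [Q Q0 Qb] := weights_consistent rs cC c0 at0 Tb.
have [P P0 Pb] := bounded_on_segment
  (f := fun ij : 'I_M * 'I_M => fun t => p ij.1 ij.2 (c t)) at0 Tb
  (fun ij => continuous_along_solution (pc ij.1 ij.2) cC c0).
have [B B0 Bb] := bounded_on_segment at0 Tb (fun i t =>
  C3_continuous (t := t) (cC i) (leqnn 3)).
have MPQ0 : 0 <= M%:R * (P * Q) by rewrite !mulr_ge0.
(* 3 B from the multistep formula; 3/2 times the two sums of M terms P Q. *)
exists (3 * B + 3 * (M%:R * (P * Q))); first lra.
move=> dt t i dt0 t0t tT.
have ab x : t0 <= x -> x <= T -> a < x < b.
  by move=> ? ?; apply/andP; split; lra.
have [t0t' tT'] : t0 <= t /\ t <= T by split; lra.
pose sg := sigma s r (c (t - 2 * dt)) (c (t - dt)) (c t).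
pose e j := c (t + dt) 0 j / sg j - 1.
have eb j : `|e j| <= Q * dt ^+ 2 by exact: Qb.
have rhsE : pds_rhs p d (c t) i = derive1n 1 (fun x => c x 0 i) t.
  by rewrite derive1n1 derive1E; have /@derive_val := cS i t (ab t t0t' tT').
have defect := @multistep_defect_le R t0 T B
  (fun k => derive1n k (fun x => c x 0 i)) _ (Bb i) dt t dt0 t0t tT.
have {}defect := defect (fun k x k3 t0x xT =>
  C3_is_derive (cC i) k3 (ab x t0x xT)).
rewrite (_ : residual p d s r c t dt i =
  (c (t + dt) 0 i - 1 / 4 * c (t - 2 * dt) 0 i - 3 / 4 * c t 0 i
    - 3 / 2 * dt * pds_rhs p d (c t) i)
  - 3 / 2 * dt * (\sum_j p i j (c t) * e j - \sum_j p j i (c t) * e i));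
  last first.
  rewrite /residual /mp_rhs /pds_rhs /e /sg.
  under [X in _ = _ - _ * (X - _)]eq_bigr do rewrite mulrBr mulr1.
  under [X in _ = _ - _ * (_ - X)]eq_bigr do rewrite mulrBr mulr1 pdE.
  by rewrite !sumrB; ring.
have sumb (q : 'I_M -> 'I_M * 'I_M) (k : 'I_M -> 'I_M) :
    `|\sum_j p (q j).1 (q j).2 (c t) * e (k j)| <= M%:R * (P * Q) * dt ^+ 2.
  apply: le_trans (ler_norm_sum _ _ _) _.
  rewrite -[X in X%:R]card_ord -!mulrA mulr_natl -sumr_const ler_sum// => j _.
  by rewrite normrM ler_pM// (Pb (q j)).
have s1 := sumb (fun j => (i, j)) id.
have s2 := sumb (fun j => (j, i)) (fun=> i).
rewrite /= in s1 s2; rewrite rhsE.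
apply: le_trans (ler_normB _ _) _.
rewrite [leRHS]mulrDl lerD// {defect}.
rewrite normrM ger0_norm; last lra.
apply: le_trans (ler_wpM2l _ (le_trans (ler_normB _ _) (lerD s1 s2))) _; lra.
Qed.

(** * One step of the scheme *)

Lemma mp_rhs_production {R : realType} {M : nat}
    {p d : 'I_M -> 'I_M -> 'rV[R]_M -> R} {s r dt : R} {u v w z} {i : 'I_M} :
  (forall i j u, p i j u = d j i u) ->
  mp_rhs p d s r dt u v w z i =
    1 / 4 * u 0 i + 3 / 4 * w 0 i + 3 / 2 * dt *
      (\sum_j p i j w * (z 0 j / sigma s r u v w j)
       - \sum_j p j i w * (z 0 i / sigma s r u v w i)).
Proof.
by move=> pdE; rewrite /mp_rhs; under [X in _ - X]eq_bigr do rewrite -pdE.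
Qed.

Lemma sigma_ge0 {R : realType} {M : nat} (s r : R) (u v w : 'rV[R]_M) i :
  0 <= sigma s r u v w i.
Proof. by rewrite /sigma !mulr_ge0 ?powR_ge0. Qed.

Lemma mp_step_mass {R : realType} {M : nat}
    {p d : 'I_M -> 'I_M -> 'rV[R]_M -> R} {s r dt : R} {u v w z} :
  (forall i j u, p i j u = d j i u) -> mp_step p d s r dt u v w z ->
  mass z = 1 / 4 * mass u + 3 / 4 * mass w.
Proof.
move=> pdE zstep; rewrite /mass (eq_bigr _ (fun i _ => zstep i)).
under eq_bigr do rewrite (mp_rhs_production pdE).
by rewrite !big_split /= -!mulr_sumr exchange_sum0 mulr0 addr0.
Qed.

(** Stability and conservation together give sum |z_i| <= sum z_i. *)
Lemma mp_step_ge0 {R : realType} {M : nat}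
    {p d : 'I_M -> 'I_M -> 'rV[R]_M -> R} {s r dt : R} {u v w z} :
  (forall i j u, p i j u = d j i u) -> (forall i j, 0 <= p i j w) ->
  0 <= dt -> nonneg_state u -> nonneg_state w ->
  mp_step p d s r dt u v w z -> nonneg_state z.
Proof.
move=> pdE p0 dt0 u0 w0 zstep i.
have l1 : \sum_j `|z 0 j| <= \sum_j `|1 / 4 * u 0 j + 3 / 4 * w 0 j|.
  apply: (patankar_l1_stable (P := fun i j => p i j w) (wt := sigma s r u v w)
    (D := 3 / 2 * dt)) => //.
  - lra.
  - by move=> j; exact: sigma_ge0.
  by move=> j; rewrite -(mp_rhs_production pdE).
have : \sum_j (`|z 0 j| - z 0 j) <= 0.
  rewrite sumrB subr_le0 (le_trans l1)// -/(mass z) (mp_step_mass pdE zstep).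
  rewrite /mass !mulr_sumr -big_split /= ler_sum// => j _.
  by rewrite ger0_norm; have := u0 j; have := w0 j; lra.
rewrite (bigD1 i) //= => neg.
have : 0 <= \sum_(j | j != i) (`|z 0 j| - z 0 j).
  by apply: sumr_ge0 => j _; rewrite subr_ge0 ler_norm.
by have := normr_ge0 (z 0 i); lra.
Qed.

(** With the exact data fixed in sigma and p, the step is linear in z, and
    c(t + dt) solves it up to the residual; the difference therefore solves it
    with the opposite of the residual as explicit part. *)
Lemma mp_step_error_le {R : realType} {M : nat}
    {p d : 'I_M -> 'I_M -> 'rV[R]_M -> R} {s r t dt : R} {c : R -> 'rV[R]_M}
    {z} :
  (forall i j u, p i j u = d j i u) -> (forall i j, 0 <= p i j (c t)) ->
  0 <= dt -> mp_step p d s r dt (c (t - 2 * dt)) (c (t - dt)) (c t) z ->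
  \sum_i `|z 0 i - c (t + dt) 0 i| <= \sum_i `|residual p d s r c t dt i|.
Proof.
move=> pdE p0 dt0 zstep.
under [leRHS]eq_bigr do rewrite -normrN.
apply: (patankar_l1_stable (P := fun i j => p i j (c t))
  (wt := sigma s r (c (t - 2 * dt)) (c (t - dt)) (c t))
  (D := 3 / 2 * dt)) => //.
- lra.
- by move=> j; exact: sigma_ge0.
move=> j; rewrite [z 0 j in LHS]zstep /residual !(mp_rhs_production pdE).
under [X in _ = _ + _ * (X - _)]eq_bigr do rewrite mulrBl mulrBr.
under [X in _ = _ + _ * (_ - X)]eq_bigr do rewrite mulrBl mulrBr.
by rewrite !sumrB; ring.
Qed.

Theorem theorem2p3 (R : realType) (M : nat)
    (p d : 'I_M -> 'I_M -> 'rV[R]_M -> R) (s r : R)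
    (pdE : forall i j u, p i j u = d j i u)
    (p_ge0 : forall i j u, nonneg_state u -> 0 <= p i j u) :
  [/\ (forall i j, {within [set u | pos_state u], continuous (p i j)}) ->
        r + 2 * s - 3 = 0 -> second_order_accurate p d s r,
      conservative p d s r &
      positivity_preserving p d s r].
Proof.
split.
- move=> pc rs a b c sol t0 T at0 Tb.
  have [K K0 Kb] := residual_le pdE pc rs sol at0 Tb.
  have [_ c0 _] := sol.
  (* K for the residual; passing from one component to the l1 norm costs M. *)
  exists (K + M%:R * K); near=> dt => t t0t tT i.
  have dt0 : 0 < dt by [].
  have Kdt : 0 <= K * dt ^+ 3 by rewrite mulr_ge0// exprn_ge0// ltW.
  have MKdt : 0 <= M%:R * (K * dt ^+ 3) by rewrite mulr_ge0.
  rewrite mulrDl -mulrA; split.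
    by apply: le_trans (Kb dt t i dt0 t0t tT) _; rewrite lerDl.
  move=> z zstep.
  have p0 k j : 0 <= p k j (c t).
    by apply: p_ge0 => l; apply/ltW/c0; apply/andP; split; lra.
  apply: (@le_trans _ _ (\sum_j `|z 0 j - c (t + dt) 0 j|)).
    by rewrite (bigD1 i) //= lerDl sumr_ge0.
  apply: le_trans (mp_step_error_le pdE p0 (ltW dt0) zstep) _.
  apply: (@le_trans _ _ (M%:R * (K * dt ^+ 3))); last by rewrite lerDr.
  rewrite -[X in X%:R]card_ord mulr_natl -sumr_const ler_sum// => j _.
  exact: Kb.
- move=> dt N C dt0 run m01 m12.
  have step n : (n.+2 < N)%N -> mass (C n.+3) =
      1 / 4 * mass (C n) + 3 / 4 * mass (C n.+2).
    by move=> /run; exact: mp_step_mass.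
  elim=> [|n IH] nN; first by split=> //; rewrite step//; lra.
  have [e1 e2 e3] := IH (ltnW nN); split=> //; rewrite [RHS]step//; lra.
- move=> dt u v w z dt0 zstep u0 v0 w0.
  by apply: mp_step_ge0 zstep => // [i j|]; [exact: p_ge0|exact: ltW].
Unshelve. all: by end_near. Qed.
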